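(* Let $(\mathcal K,[\cdot,\cdot])$ be a Krein space with fundamental symmetry $J$ and associated Hilbert space inner product $[x,y]_J=[x,Jy]$. Let $\{z_n\}_{n=1}^\infty$ and $\{z'_n\}_{n=1}^\infty$ be two frames for the Krein space $(\mathcal K,[\cdot,\cdot])$. Then the following are equivalent: (1) $\{z_n\}_{n=1}^\infty$ and $\{z'_n\}_{n=1}^\infty$ are weaving frames for $(\mathcal K,[\cdot,\cdot])$. (2) $\{Jz_n\}_{n=1}^\infty$ and $\{Jz'_n\}_{n=1}^\infty$ are weaving frames for $(\mathcal K,[\cdot,\cdot])$. (3) $\{z_n\}_{n=1}^\infty$ and $\{z'_n\}_{n=1}^\infty$ are weaving frames for $(\mathcal K,[\cdot,\cdot]_J)$. (4) $\{Jz_n\}_{n=1}^\infty$ and $\{Jz'_n\}_{n=1}^\infty$ are weaving frames for $(\mathcal K,[\cdot,\cdot]_J)$.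
   Context: $(\mathcal K,[\cdot,\cdot])$ is a Krein space with fundamental decomposition $\mathcal K=\mathcal K_{\delta^+}\oplus\mathcal K_{\delta^-}$, where $(\mathcal K_{\delta^+},[\cdot,\cdot])$ and $(\mathcal K_{\delta^-},-[\cdot,\cdot])$ are Hilbert spaces that are mutually $[\cdot,\cdot]$-orthogonal. The fundamental symmetry is $J(k_{\delta^+}+k_{\delta^-})=k_{\delta^+}-k_{\delta^-}$. The $J$-inner product $[k,k']_J=[k,Jk']$ makes $\mathcal K$ a Hilbert space, with norm $\|k\|_J^2=[k,Jk]$. A sequence $\{z_n\}_{n=1}^\infty$ in $\mathcal K$ is a frame for $(\mathcal K,[\cdot,\cdot])$ if there are constants $0<\alpha\le\beta$ such that $\alpha\|k\|_J^2\le\sum_{n=1}^\infty|[k,z_n]|^2\le\beta\|k\|_J^2$ for all $k\in\mathcal K$. Two frames $\{z_n\}$ and $\{z'_n\}$ for $(\mathcal K,[\cdot,\cdot])$ are weaving frames for $(\mathcal K,[\cdot,\cdot])$ if for every $\sigma\subset\mathbb N$ the family $\{z_n\}_{n\in\sigma}\cup\{z'_n\}_{n\in\sigma^c}$ is a frame, with universal bounds: there are constants $0<\alpha\le\beta$ such that for all $\sigma\subset\mathbb N$ and all $k\in\mathcal K$, $$\alpha\|k\|_J^2\le\sum_{n\in\sigma}|[k,z_n]|^2+\sum_{n\in\sigma^c}|[k,z'_n]|^2\le\beta\|k\|_J^2.$$ Frames and weaving frames for the Hilbert space $(\mathcal K,[\cdot,\cdot]_J)$ are defined in the same way, with $[\cdot,\cdot]_J$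 in place of $[\cdot,\cdot]$ in the sums. *)

(* Defs.v *)
From HB Require Import structures.
From mathcomp Require Import all_boot all_order all_algebra.
From mathcomp Require Import complex.
From mathcomp Require Import all_classical all_reals all_analysis.

Set Implicit Arguments.
Unset Strict Implicit.
Unset Printing Implicit Defensive.
Import Order.TTheory GRing.Theory Num.Theory.
Local Open Scope classical_set_scope.
Local Open Scope ring_scope.

Variant scalars := RealScalars | ComplexScalars.

Definition scalar_field (R : realType) (s : scalars) : numFieldType :=
  match s with RealScalars => R | ComplexScalars => complex R end.

Definition sconj (R : realType) (s : scalars) :
    scalar_field R s -> scalar_field R s :=
  match s with
  | RealScalars => fun x : R => x
  | ComplexScalars => fun x : complex R => Num.conj x
  end.

Definition sre (R : realType) (s : scalars) : scalar_field R s -> R :=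
  match s with
  | RealScalars => fun x : R => x
  | ComplexScalars => fun x : complex R => complex.Re x
  end.

(* The norm `|x| of MathComp takes its values in the scalar field itself. *)
Definition sabs (R : realType) (s : scalars) (x : scalar_field R s) : R :=
  sre `|x|.

Section HilbertSubspace.
Variables (R : realType) (s : scalars) (V : lmodType (scalar_field R s)).
Implicit Types (H : set V) (q : V -> V -> scalar_field R s).

Definition norm_of q (x : V) : R := Num.sqrt (sre (q x x)).

(* In complex R, 0 < z means that z is real and positive. *)
Definition inner_product_on H q :=
  [/\ forall (a : scalar_field R s) (x y w : V), H x -> H y -> H w ->
        q (a *: x + y) w = a * q x w + q y w,
      forall x y, H x -> H y -> q y x = sconj (q x y) &
      forall x, H x -> x != 0 -> 0 < q x x].

Definition complete_on H q :=
  forall u : nat -> V, (forall n, H (u n)) ->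
    (forall e : R, 0 < e -> exists N : nat, forall m n : nat,
       (N <= m)%N -> (N <= n)%N -> norm_of q (u m - u n) < e) ->
    exists2 l, H l & forall e : R, 0 < e -> exists N : nat, forall n : nat,
       (N <= n)%N -> norm_of q (u n - l) < e.

Definition hilbert_on H q :=
  [/\ submod_closed (mem H), inner_product_on H q & complete_on H q].

End HilbertSubspace.

Record kreinSpace (R : realType) (s : scalars) := KreinSpace {
  ksort :> lmodType (scalar_field R s);
  kform : {hermitian_sym ksort for (@sconj R s)};
  kpos : set ksort;
  kneg : set ksort;
  kpos_hilbert : hilbert_on kpos kform;
  kneg_hilbert : hilbert_on kneg (fun x y => - kform x y);
  korthogonal : forall x y, kpos x -> kneg y -> kform x y = 0;
  kspan : forall x, exists y z, [/\ kpos y, kneg z & x = y + z];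
  kdirect : kpos `&` kneg = [set 0]
}.

Section Krein.
Variables (R : realType) (s : scalars) (K : kreinSpace R s).

Definition kpos_part (x : K) : K :=
  xget 0 [set y | @kpos R s K y /\ @kneg R s K (x - y)].

Definition kneg_part (x : K) : K := x - kpos_part x.

Definition fundamental_symmetry (x : K) : K := kpos_part x - kneg_part x.

Lemma fundamental_symmetryE (y z : K) : @kpos R s K y -> @kneg R s K z ->
  fundamental_symmetry (y + z) = y - z.
Proof.
move=> Py Nz; rewrite /fundamental_symmetry /kneg_part.
suff -> : kpos_part (y + z) = y by rewrite [y + z]addrC addrK.
rewrite /kpos_part; case: xgetP => [y' _ [Py' Nz']|/(_ y)[]]; last first.
  by split=> //; rewrite [y + z]addrC addrK.
have [Hp _ _] := kpos_hilbert K; have [Hn _ _] := kneg_hilbert K.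
have [_ Bp] := GRing.submod_closedB Hp; have [_ Bn] := GRing.submod_closedB Hn.
apply/eqP; rewrite -subr_eq0; apply/eqP.
have : (@kpos R s K `&` @kneg R s K) (y' - y); last by rewrite kdirect.
split; first by apply/set_mem/Bp; rewrite inE.
have -> : y' - y = z - (y + z - y').
  by rewrite opprB opprD addrCA [z + _]addrC subrK.
by apply/set_mem/Bn; rewrite inE.
Qed.

Definition jform (x y : K) : scalar_field R s :=
  @kform R s K x (fundamental_symmetry y).

Definition jnorm (x : K) : R := norm_of jform x.

(* Sequences are indexed from 0.  The form q is kform for the Krein space and
   jform for the associated Hilbert space; the norm is the J-norm for both. *)
Definition frame (q : K -> K -> scalar_field R s) (z : nat -> K) :=
  exists alpha beta : R, [/\ 0 < alpha, alpha <= beta &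
    forall k : K,
      ((alpha * jnorm k ^+ 2)%:E
        <= \sum_(0 <= n <oo) (sabs (q k (z n)) ^+ 2)%:E
        <= (beta * jnorm k ^+ 2)%:E)%E].

Definition weaving_frames (q : K -> K -> scalar_field R s) (z z' : nat -> K) :=
  [/\ frame q z, frame q z' &
    exists alpha beta : R, [/\ 0 < alpha, alpha <= beta &
      forall (sigma : set nat) (k : K),
        ((alpha * jnorm k ^+ 2)%:E
          <= \sum_(0 <= n <oo | n \in sigma) (sabs (q k (z n)) ^+ 2)%:E
             + \sum_(0 <= n <oo | n \in ~` sigma) (sabs (q k (z' n)) ^+ 2)%:E
          <= (beta * jnorm k ^+ 2)%:E)%E]].

End Krein.

Arguments kform {R s} k.
Arguments jform {R s} K x y.
Arguments fundamental_symmetry {R s} K x.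

(* Main.v *)
Require Import Defs.
From HB Require Import structures.
From mathcomp Require Import all_boot all_order all_algebra.
From mathcomp Require Import complex.
From mathcomp Require Import all_classical all_reals all_analysis.

(** Writing [J] for the fundamental symmetry, the indefinite form and the
    [J]-inner product determine each other: [jform x y = kform x (J y)] and,
    since [J] is an involution, [kform x y = jform x (J y)].  Hence the analysis
    coefficients of [J \o z] for one form are those of [z] for the other: passing
    from [z], [z'] to [J \o z], [J \o z'] while exchanging the two forms does not
    change the weaving condition.

    Applying [J] to the families under a fixed form is a change of variable.
    The two summands of the fundamental decomposition are orthogonal, so [J] is self-adjoint
    ([kform_symmetryC]), and as an involution it therefore preserves the
    [J]-norm ([jnorm_symmetry]).  The coefficients of [k] against [J \o z] are
    those of [J k] against [z], and [J k] has the [J]-norm of [k]; since the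
    frame inequalities quantify over all [k], replacing [k] by [J k] carries
    them from [z] to [J \o z] with the same bounds ([weaving_frames_transfer]). *)

Set Implicit Arguments.
Unset Strict Implicit.
Unset Printing Implicit Defensive.
Import GRing.Theory.
Local Open Scope ring_scope.

Section FundamentalSymmetry.
Variables (R : realType) (s : scalars) (K : kreinSpace R s).
Local Notation J := (fundamental_symmetry K).

Lemma sconj0 : sconj (0 : scalar_field R s) = 0.
Proof. by case: s => //=; rewrite rmorph0. Qed.

Lemma korthogonalC (x y : K) : kneg x -> kpos y -> kform K x y = 0.
Proof.
move=> Nx Py.
by rewrite (hermitian_subproof x y) korthogonal// sconj0 mulr0.
Qed.

Lemma kneg_opp (x : K) : kneg x -> kneg (- x).
Proof.
move=> Nx; have [/GRing.submod_closedB [_ B] _ _] := kneg_hilbert K.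
have N0 : kneg (0 : K).
  have : (@kpos _ _ K `&` @kneg _ _ K)%classic 0 by rewrite kdirect.
  by case.
by apply/set_mem; rewrite -[- x]add0r; apply: B; rewrite inE.
Qed.

Lemma fundamental_symmetryK : involutive J.
Proof.
move=> x; have [y [z [Py Nz ->]]] := kspan x.
rewrite fundamental_symmetryE// fundamental_symmetryE ?opprK//.
exact: kneg_opp.
Qed.

(** Expand along the fundamental decompositions [x = y + w], [x' = y' + w']:
    only the cross terms enter the two sides with different signs, and they are
    zero by orthogonality. *)
Lemma kform_symmetryC (x x' : K) : kform K (J x) x' = kform K x (J x').
Proof.
have [y [w [Py Nw ->]]] := kspan x; have [y' [w' [Py' Nw' ->]]] := kspan x'.
rewrite !fundamental_symmetryE// linearBl linearDl !linearBr !linearDr.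
have /= -> := korthogonal Py Nw'; have /= -> := korthogonalC Nw Py'.
by rewrite add0r addr0 sub0r subr0.
Qed.

Lemma jform_symmetryr (x y : K) : jform K x (J y) = kform K x y.
Proof. by rewrite /jform fundamental_symmetryK. Qed.

Lemma jnorm_symmetry (x : K) : jnorm (J x) = jnorm x.
Proof.
by rewrite /jnorm /norm_of jform_symmetryr kform_symmetryC.
Qed.

(** Reparametrizing the test vector by a [J]-norm preserving map [f] changes
    neither the bounds nor the quantification, so it suffices that the
    coefficients of [k] for the new family are those of [f k] for the old. *)
Lemma weaving_frames_transfer (q q' : K -> K -> scalar_field R s)
    (z z' w w' : nat -> K) (f : K -> K) :
    (forall k, jnorm (f k) = jnorm k) ->
    (forall k n, q' k (w n) = q (f k) (z n)) ->
    (forall k n, q' k (w' n) = q (f k) (z' n)) ->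
  weaving_frames q z z' -> weaving_frames q' w w'.
Proof.
move=> fN qz qz' [[a [b [a0 ab zP]]] [c [d [c0 cd z'P]]] [e [g [e0 eg zzP]]]].
split.
- exists a, b; split=> // k; have := zP (f k); rewrite fN.
  by under eq_eseriesr do rewrite -qz.
- exists c, d; split=> // k; have := z'P (f k); rewrite fN.
  by under eq_eseriesr do rewrite -qz'.
- exists e, g; split=> // sigma k; have := zzP sigma (f k); rewrite fN.
  under eq_eseriesr do rewrite -qz.
  by under [X in (_ + X)%E]eq_eseriesr do rewrite -qz'.
Qed.

End FundamentalSymmetry.

Theorem theorem2p3 (R : realType) (s : scalars) (K : kreinSpace R s)
    (z z' : nat -> K) (hz : frame (kform K) z) (hz' : frame (kform K) z') :
  let J := fundamental_symmetry K in
  [<-> weaving_frames (kform K) z z';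
       weaving_frames (kform K) (J \o z) (J \o z');
       weaving_frames (jform K) z z';
       weaving_frames (jform K) (J \o z) (J \o z')].
Proof.
move=> J; tfae.
- by apply: (weaving_frames_transfer (f := J)) => [k|k n|k n] /=;
    rewrite ?jnorm_symmetry ?kform_symmetryC.
- exact: (weaving_frames_transfer (f := id)).
- by apply: (weaving_frames_transfer (f := J)) => [k|k n|k n] /=;
    rewrite ?jnorm_symmetry// jform_symmetryr /jform kform_symmetryC
            fundamental_symmetryK.
- by apply: (weaving_frames_transfer (f := id)) => // k n /=;
    rewrite jform_symmetryr.
Qed.
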